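(* Let $m,n\ge 2$ be integers and let $\mathcal{A}\in T_{m,n}$ be a column adequate tensor. Then all principal sub-tensors of $\mathcal{A}$ are column adequate tensors; that is, for every nonempty $J\subseteq[n]$ with $|J|=r$, the principal sub-tensor $\mathcal{A}^J_r$ is column adequate.
   Context: $[n]=\{1,\dots,n\}$. $T_{m,n}$ denotes the set of real tensors $\mathcal{A}=(a_{i_1 i_2\cdots i_m})$ of order $m$ and dimension $n$, with $i_j\in[n]$ for $j\in[m]$. For $x\in\mathbb{R}^n$, $\mathcal{A}x^{m-1}\in\mathbb{R}^n$ is the vector with components $(\mathcal{A}x^{m-1})_i=\sum_{i_2,\dots,i_m=1}^n a_{i i_2\cdots i_m}x_{i_2}\cdots x_{i_m}$, $i\in[n]$ (the same definition is used in any dimension $r\ge1$). Column adequate tensor: $\mathcal{A}$ (of order $m$ and dimension $n$) is column adequate if, for every $x\in\mathbb{R}^n$, $x_i(\mathcal{A}x^{m-1})_i\le 0$ for all $i\in[n]$ implies $\mathcal{A}x^{m-1}=0$. Principal sub-tensor: for $J\subseteq[n]$ with $|J|=r$, $1\le r\le n$, $\mathcal{A}^J_r=(a_{i_1i_2\cdots i_m})_{i_1,\dots,i_m\in J}$, a tensor of order $m$ and dimension $r$ (indices ranging over $J$). *)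

(* Defs.v *)
From HB Require Import structures.
From mathcomp Require Import all_boot all_order all_algebra.
From mathcomp Require Import reals.

Set Implicit Arguments.
Unset Strict Implicit.
Unset Printing Implicit Defensive.

Import Order.TTheory GRing.Theory Num.Theory.
Local Open Scope ring_scope.

Definition tensor (R : Type) (m n : nat) := {ffun m.-tuple 'I_n -> R}.

(* The vector A x^(m-1). The sum ranges over the trailing indices
   (i_2, ..., i_m). The value at order 0 is a dummy. *)
Definition tensor_apply (R : realType) (m n : nat) :
    tensor R m n -> 'cV[R]_n -> 'cV[R]_n :=
  match m with
  | 0 => fun _ _ => 0
  | k.+1 => fun A x =>
      \col_(i < n) \sum_(t : k.-tuple 'I_n)
         A [tuple of i :: t] * \prod_(j < k) x (tnth t j) 0
  end.

Definition column_adequate (R : realType) (m n : nat) (A : tensor R m n) : Prop :=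
  forall x : 'cV[R]_n,
    (forall i : 'I_n, x i 0 * tensor_apply A x i 0 <= 0) ->
    tensor_apply A x = 0.

(* The index set J is identified with 'I_#|J| through its increasing
   enumeration [enum_val]. *)
Definition principal_subtensor (R : realType) (m n : nat) (A : tensor R m n)
    (J : {set 'I_n}) : tensor R m #|J| :=
  [ffun t : m.-tuple 'I_#|J| => A [tuple of map (@enum_val _ (mem J)) t]].

(* Main.v *)
(* Extend x by zero outside J: the trailing sum then only sees indices in J, so
   on J the vector A y^(m-1) agrees with the one of the sub-tensor at x, while
   off J the sign condition holds because y vanishes there. *)
Require Import Defs.
From mathcomp Require Import all_boot all_order all_algebra.
From mathcomp Require Import reals.

Set Implicit Arguments.
Unset Strict Implicit.
Unset Printing Implicit Defensive.

Import Order.TTheory GRing.Theory Num.Theory.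
Local Open Scope ring_scope.

Section ZeroExtension.

Variables (R : realType) (n : nat) (J : {set 'I_n}) (i0 : 'I_n) (Ji0 : i0 \in J).

(** The witness [Ji0] makes [enum_rank_in] total; the default rank it returns off [J] is masked by
    the [if]. *)
Definition zero_extension (x : 'cV[R]_#|J|) : 'cV[R]_n :=
  \col_i if i \in J then x (enum_rank_in Ji0 i) 0 else 0.

Lemma zero_extension_val (x : 'cV[R]_#|J|) (k : 'I_#|J|) :
  zero_extension x (enum_val k) 0 = x k 0.
Proof. by rewrite mxE enum_valP enum_valK_in. Qed.

Lemma zero_extension_out (x : 'cV[R]_#|J|) (i : 'I_n) :
  i \notin J -> zero_extension x i 0 = 0.
Proof. by rewrite mxE => /negPf ->. Qed.

Lemma tensor_apply_zero_extension (m : nat) (A : tensor R m n)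
    (x : 'cV[R]_#|J|) (k : 'I_#|J|) :
  tensor_apply A (zero_extension x) (enum_val k) 0 =
  tensor_apply (principal_subtensor A J) x k 0.
Proof.
case: m A => [|m] A /=; first by rewrite !mxE.
rewrite [LHS]mxE [RHS]mxE.
rewrite (bigID (fun t : m.-tuple 'I_n => all (mem J) t)) /=.
(* A trailing tuple with an entry outside [J] has a zero factor in its product. *)
rewrite [X in _ + X]big1 ?addr0; last first.
  move=> t /allPn[i /tnthP[j ->] tjJ].
  by rewrite (bigD1 j) //= zero_extension_out // mul0r mulr0.
(* Tuples with all entries in [J] correspond bijectively to tuples over ['I_#|J|], by applying
   [enum_val] entrywise, with inverse [enum_rank_in Ji0]. *)
rewrite (reindex_onto (map_tuple (@enum_val _ (mem J)))
                      (map_tuple (enum_rank_in Ji0))) /=; last first.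
  move=> t /allP tJ; apply: eq_from_tnth => j.
  by rewrite !tnth_map enum_rankK_in //; apply: tJ (mem_tnth j t).
apply: eq_big => [t|t _].
  apply/andP; split; first by apply/allP => _ /mapP[j _ ->]; apply: enum_valP.
  by apply/eqP/eq_from_tnth => j; rewrite !tnth_map enum_valK_in.
(* The two index tuples differ only in their proofs of length. *)
rewrite ffunE; congr (A _ * _); first exact: val_inj.
by apply: eq_bigr => j _; rewrite tnth_map zero_extension_val.
Qed.

End ZeroExtension.

Theorem theorem3p2 (R : realType) (m n : nat) (hm : (2 <= m)%N) (hn : (2 <= n)%N)
    (A : tensor R m n) (hA : column_adequate A) (J : {set 'I_n}) (hJ : J != set0) :
  column_adequate (principal_subtensor A J).
Proof.
have /set0Pn[i0 Ji0] := hJ.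
move=> x hx.
have Ay0 : tensor_apply A (zero_extension Ji0 x) = 0.
  apply: hA => i; have [iJ|iJ] := boolP (i \in J); last first.
    by rewrite zero_extension_out // mul0r.
  (* Writing [i] as the [enum_val] of its rank turns the sign condition at [i] into an instance of
     [hx]. *)
  rewrite -(enum_rankK_in Ji0 iJ) zero_extension_val.
  by rewrite tensor_apply_zero_extension hx.
apply/colP => k.
by rewrite -(tensor_apply_zero_extension Ji0) Ay0 !mxE.
Qed.
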